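(* Define integers $C_{1^{-2}2^{3}4^{2}}(n)$ by the formal power series identity \[ \frac{(q^2;q^2)_\infty^{3}\,(q^4;q^4)_\infty^{2}}{(q;q)_\infty^{2}}=\sum_{n\geq 0} C_{1^{-2}2^{3}4^{2}}(n)\,q^n . \] Then for every $n\in\mathbb N_0$ we have $C_{1^{-2}2^{3}4^{2}}(n)>0$.
   Context: For $a$ and a formal variable $q$, $(a;q)_\infty:=\prod_{j\geq 0}(1-aq^j)$ is the $q$-Pochhammer symbol. (Equivalently, up to the factor $q^{1/3}$, the series is the $q$-expansion of the eta-quotient $\eta(2z)^3\eta(4z)^2/\eta(z)^2$, where $\eta(z)=q^{1/24}\prod_{n\ge1}(1-q^n)$, $q=e^{2\pi i z}$.) *)

(* Defs.v *)
From mathcomp Require Import all_boot all_order all_algebra.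
Set Implicit Arguments. Unset Strict Implicit. Unset Printing Implicit Defensive.
Import GRing.Theory Num.Theory.
Local Open Scope ring_scope.

(* (q^m; q^m)_infty truncated to the factors j = 1..N :
   \prod_{j=1}^{N} (1 - q^{m j}).  Modulo q^{N+1} (m >= 1) this agrees with
   the infinite product, since the factors with j > N are 1 mod q^{N+1}. *)
Definition qpoch_trunc (m N : nat) : {poly int} :=
  \prod_(1 <= j < N.+1) (1 - 'X^(m * j)).

(* 1/(q^m; q^m)_infty truncated: \prod_{j=1}^{N} \sum_{k=0}^{N} q^{m j k};
   agrees with the formal power series 1/(q^m;q^m)_infty modulo q^{N+1}
   (for m >= 1). *)
Definition qpoch_inv_trunc (m N : nat) : {poly int} :=
  \prod_(1 <= j < N.+1) \sum_(k < N.+1) 'X^(m * j * k).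

Definition C_eta (n : nat) : int :=
  (qpoch_trunc 2 n ^+ 3 * qpoch_trunc 4 n ^+ 2 * qpoch_inv_trunc 1 n ^+ 2)`_n.

(* Main.v *)
Require Import Defs.
From mathcomp Require Import all_boot all_order all_algebra.
From mathcomp Require Import zify ring.
Import GRing.Theory Num.Theory.
Local Open Scope ring_scope.
Set Implicit Arguments. Unset Strict Implicit. Unset Printing Implicit Defensive.

(* The generating function f of [C_eta] equals the Hecke-type double sum
     H(q) = sum_(k >= 0) t_k q^k / (1 - q^(2k+1)),
     t_k = q^(k^2+k) sum_(|b| <= k) q^(-b^2-b),
   whose coefficients are nonnegative, while the term k = 0 is 1 / (1 - q).

   To see f = H, extend t_k and K_k = q^k / (1 - q^(2k+1)) antisymmetrically
   under k -> -1-k, and put t(w) = sum t_k w^k, K(w) = sum K_k w^k,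
   theta4 = sum (-1)^n q^(n^2) w^n, theta3 = sum q^(n^2) w^n and
   theta1 = sum (-1)^n q^(n^2+n) w^n.  First-order recursions show that
   K theta4 = c theta1, that t theta1 is a multiple of theta4 theta3 / w, and
   hence that t K is a multiple of theta3 / w; its coefficient of w^-1 is -2 H.
   Evaluation at the poles of K and t determines the constants and yields
     H phi(q) phi(-q)^2 = J^2
   with phi(q) = sum q^(n^2) and J = sum n (-1)^n q^(n^2+n).  By the triple
   product identity phi(-q) = (q;q)^2 / (q^2;q^2) and J = (q^2;q^2)^3, so that
   H = (q^2;q^2)^3 (q^4;q^4)^2 / (q;q)^2.

   All this takes place in a ring where q is nilpotent, in the end Z[q]/q^(n+1).
   There bilateral series are finite sums, and only the coefficients in w are
   ever manipulated. *)

(** * Sums over a symmetric window of integers *)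

Definition bsum (V : zmodType) (L : nat) (f : int -> V) : V :=
  \sum_(i < L.*2.+1) f (i%:Z - L%:Z).

Section BilateralSums.
Variables (V : zmodType) (L : nat).
Implicit Types (f g : int -> V) (k s : int).

Lemma eq_bsum f g :
  (forall k, (`|k| <= L)%N -> f k = g k) -> bsum L f = bsum L g.
Proof.
by move=> fg; apply: eq_bigr => i _; apply: fg; have := ltn_ord i; lia.
Qed.

Lemma bsumN f : bsum L (fun k => f (- k)) = bsum L f.
Proof.
rewrite /bsum (reindex_inj rev_ord_inj); apply: eq_bigr => i _ /=.
by congr f; have := ltn_ord i; lia.
Qed.

Lemma bsumS f :
  bsum L (fun k => f (k + 1)) + f (- L%:Z) = bsum L f + f (L%:Z + 1).
Proof.
rewrite /bsum [X in _ = X + _]big_ord_recl big_ord_recr /=.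
rewrite [LHS]addrC addrA; congr (_ + _ + _).
- by congr f; lia.
- by apply: eq_bigr => i _; congr f; rewrite /bump /=; lia.
by congr f; lia.
Qed.

Lemma bsumD f g : bsum L (fun k => f k + g k) = bsum L f + bsum L g.
Proof. exact: big_split. Qed.

Lemma bsumB f g : bsum L (fun k => f k - g k) = bsum L f - bsum L g.
Proof. exact: sumrB. Qed.

Lemma bsum_opp f : bsum L (fun k => - f k) = - bsum L f.
Proof. exact: sumrN. Qed.

Lemma exchange_bsum (F : int -> int -> V) :
  bsum L (fun i => bsum L (F i)) = bsum L (fun j => bsum L (F^~ j)).
Proof. exact: exchange_big. Qed.

(** A unit shift changes a window sum by two boundary terms only, and both vanish while the shifted
    support stays inside the window. Negative shifts follow by reflection. *)
Lemma bsum_shift (B : nat) f s :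
  (forall k, (B < `|k|)%N -> f k = 0) -> (B + `|s| <= L)%N ->
  bsum L (fun k => f (k + s)) = bsum L f.
Proof.
have shiftn (n : nat) g : (forall k, (B < `|k|)%N -> g k = 0) ->
    (B + n <= L)%N -> bsum L (fun k => g (k + n%:Z)) = bsum L g.
  move=> g0; elim: n => [|n IHn] BL.
    by apply: eq_bsum => k _; rewrite addr0.
  rewrite -IHn; last by lia.
  have := bsumS (fun k => g (k + n%:Z)); rewrite !g0 ?addr0; try lia.
  by move=> <-; apply: eq_bsum => k _; congr g; lia.
move=> f0; case: s => n BL; first exact: shiftn.
rewrite -[RHS]bsumN -(shiftn n.+1 (fun k => f (- k))); first last.
- by lia.
- by move=> k Bk; apply: f0; lia.
by rewrite -bsumN; apply: eq_bsum => k _; congr f; lia.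
Qed.

Lemma bsum_rev (B : nat) f s :
  (forall k, (B < `|k|)%N -> f k = 0) -> (B + `|s| <= L)%N ->
  bsum L (fun k => f (s - k)) = bsum L f.
Proof.
move=> f0 BL; rewrite -bsumN -(bsum_shift f0 BL).
by apply: eq_bsum => k _; congr f; lia.
Qed.

Lemma bsum_delta f : (forall k, k != 0 -> f k = 0) -> bsum L f = f 0.
Proof.
move=> f0; have L0 : (L < L.*2.+1)%N by lia.
rewrite /bsum (bigD1 (Ordinal L0)) //= subrr big1 ?addr0 // => i iL.
by apply: f0; apply: contraNneq iL => iL; apply/eqP/val_inj => /=; lia.
Qed.

(** The cut suits the symmetry k -> -1-k, since [Negz i] is -1-i; the index L is left without a
    partner. *)
Lemma bsum_halves f :
  bsum L f = \sum_(i < L) f (Negz i) + \sum_(i < L) f (Posz i) + f L.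
Proof.
rewrite /bsum -addnn -addnS big_split_ord /= -addrA; congr (_ + _).
  rewrite (reindex_inj rev_ord_inj); apply: eq_bigr => i _ /=.
  by congr f; have := ltn_ord i; lia.
rewrite big_ord_recr /=; congr (_ + f _); last by lia.
by apply: eq_bigr => i _; congr f; lia.
Qed.

End BilateralSums.

Lemma mulr_bsumr (R : pzRingType) L (f : int -> R) a :
  a * bsum L f = bsum L (fun k => a * f k).
Proof. exact: mulr_sumr. Qed.

Lemma mulr_bsuml (R : pzRingType) L (f : int -> R) a :
  bsum L f * a = bsum L (fun k => f k * a).
Proof. exact: mulr_suml. Qed.

Definition sgi (R : pzRingType) (k : int) : R := (-1) ^+ `|k|%N.

Section Signs.
Variable R : pzRingType.
Implicit Types k l : int.
Lemma sgiE k : sgi R k = (-1) ^+ odd `|k|%N.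
Proof. by rewrite signr_odd. Qed.
Lemma sgiD k l : sgi R (k + l) = sgi R k * sgi R l.
Proof. by rewrite !sgiE -signr_addb; congr (_ ^+ nat_of_bool _); lia. Qed.
Lemma sgiN k : sgi R (- k) = sgi R k.
Proof. by rewrite /sgi abszN. Qed.
Lemma sgi1 : sgi R 1 = -1. Proof. by rewrite /sgi expr1. Qed.
Lemma sgi0 : sgi R 0 = 1. Proof. by rewrite /sgi expr0. Qed.
End Signs.

(** * The finite triple product *)

Fixpoint qbin (R : pzRingType) (q : R) (n k : nat) : R :=
  match n, k with
  | _, 0 => 1
  | 0, _.+1 => 0
  | n'.+1, k'.+1 => qbin q n' k' + q ^+ k * qbin q n' k
  end.

Definition qfact (R : pzRingType) (q : R) (n : nat) : R :=
  \prod_(j < n) (1 - q ^+ j.+1).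

Section FiniteTripleProduct.
Variables (R : comNzRingType) (q : R).

Lemma qbin0 n : qbin q n 0 = 1. Proof. by case: n. Qed.

Lemma qbinS n k :
  qbin q n.+1 k.+1 = qbin q n k + q ^+ k.+1 * qbin q n k.+1.
Proof. by []. Qed.

Lemma qbin_small n k : (n < k)%N -> qbin q n k = 0.
Proof.
elim: n k => [|n IHn] [|k] // nk; rewrite qbinS !IHn ?mulr0 ?addr0 //.
by rewrite ltnW.
Qed.

(** The second q-Pascal rule: in the triple product a new factor in x calls for this one, a new
    factor in y for the defining one. *)
Lemma qbinS_sym n k : (k <= n)%N ->
  qbin q n.+1 k.+1 = qbin q n k.+1 + q ^+ (n - k) * qbin q n k.
Proof.
elim: n k => [|n IHn] [|k] // kn.
- by rewrite /= mulr0 addr0 add0r mulr1.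
- by rewrite qbinS [in LHS]IHn // [in RHS]qbinS !qbin0 !subn0 !exprS; ring.
rewrite qbinS [qbin q n.+1 k.+1 in LHS]IHn // ?subSS.
have [lt_kn|] := ltnP k n; last first.
  move=> nk; have -> : k = n by lia.
  rewrite (@qbin_small n.+1 n.+2) // [qbin q n.+1 n.+1]qbinS.
  by rewrite (@qbin_small n n.+1) // subnn; ring.
rewrite [qbin q n.+1 k.+2 in LHS]IHn // [qbin q n.+1 k.+2 in RHS]qbinS.
rewrite [qbin q n.+1 k.+1]qbinS.
have -> : (n - k)%N = (n - k.+1).+1 by lia.
by rewrite !exprS; ring.
Qed.

(** Denominators are cleared, as no division is available. The step rests on 1 - q^(a+b+2) = (1 -
    q^(a+1)) + q^(a+1) (1 - q^(b+1)). *)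
Lemma qbin_fact a b :
  qbin q (a + b) a * (qfact q a * qfact q b) = qfact q (a + b).
Proof.
have [n ab] := ubnP (a + b); elim: n a b ab => // n IHn [|a] [|b] abn.
- by rewrite qbin0 /qfact !big_ord0 !mul1r.
- by rewrite qbin0 mul1r {1}/qfact big_ord0 mul1r.
- have -> : qbin q (a.+1 + 0) a.+1 = 1.
    elim: {abn} a => [|a IHa]; first by rewrite /= mulr0 addr0.
    by rewrite addSn qbinS IHa qbin_small ?mulr0 ?addr0 // addn0.
  by rewrite addn0 mul1r {2}/qfact big_ord0 mulr1.
rewrite addSn qbinS mulrDl.
have factS m : qfact q m.+1 = qfact q m * (1 - q ^+ m.+1).
  by rewrite /qfact big_ord_recr.
have e1 := IHn a b.+1 ltac:(lia); have e2 := IHn a.+1 b ltac:(lia).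
have e3 : (a.+1 + b = a + b.+1)%N by lia.
rewrite e3 in e2.
transitivity (qbin q (a + b.+1) a * (qfact q a * qfact q b.+1) * (1 - q ^+ a.+1)
  + q ^+ a.+1 * (qbin q (a + b.+1) a.+1 * (qfact q a.+1 * qfact q b) *
     (1 - q ^+ b.+1))).
  by rewrite !factS; ring.
rewrite e1 e2 factS -addSn exprD; ring.
Qed.

Variables (x y : R).
Hypothesis xy : x * y = q.

(* The factor x ^+ k * q ^+ 'C(k, 2) for k = i - a, where negative powers
   of x are replaced by powers of y = q / x. *)
Definition jcoef (a i : nat) : R :=
  if (a <= i)%N then x ^+ (i - a) * q ^+ 'C(i - a, 2)
  else y ^+ (a - i) * q ^+ 'C(a - i, 2).

Lemma jcoef_r a k : jcoef a (a + k) = x ^+ k * q ^+ 'C(k, 2).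
Proof. by rewrite /jcoef leq_addr addKn. Qed.

Lemma jcoef_l i k : jcoef (i + k) i = y ^+ k * q ^+ 'C(k, 2).
Proof.
rewrite /jcoef; case: k => [|k]; first by rewrite addn0 leqnn subnn !expr0.
by rewrite leqNgt addnS ltnS leq_addr /= -addnS addKn.
Qed.

(** Consecutive coefficients have ratio x q^(i-a); the power of q on the left avoids negative
    exponents. *)
Lemma jcoef_mulx a b i : (i <= a + b)%N ->
  q ^+ (a + b - i) * jcoef a i.+1 = x * q ^+ b * jcoef a i.
Proof.
move=> iab; have [ai|ia] := leqP a i.
  have [k ik] : exists k, i = (a + k)%N by exists (i - a)%N; lia.
  rewrite ik -addnS !jcoef_r binS bin1 exprD.
  have -> : q ^+ b = q ^+ (a + b - (a + k)) * q ^+ k.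
    by rewrite -exprD; congr (_ ^+ _); lia.
  by rewrite (exprS x); ring.
have [k ak] : exists k, a = (i.+1 + k)%N by exists (a - i.+1)%N; lia.
rewrite ak jcoef_l addSnnS jcoef_l binS bin1 exprD.
have -> : (i + k.+1 + b - i = 1 + k + b)%N by lia.
by rewrite !exprD expr1 -{1}xy (exprS y); ring.
Qed.

Lemma jcoef_muly a i : q ^+ i.+1 * jcoef a i = y * q ^+ a * jcoef a i.+1.
Proof.
have [ai|ia] := leqP a i.
  have [k ik] : exists k, i = (a + k)%N by exists (i - a)%N; lia.
  rewrite ik -addnS !jcoef_r binS bin1 !exprD.
  have -> : q ^+ k.+1 = x * y * q ^+ k by rewrite exprS xy.
  by rewrite (exprS x); ring.
have [k ak] : exists k, a = (i.+1 + k)%N by exists (a - i.+1)%N; lia.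
rewrite ak jcoef_l addSnnS jcoef_l binS bin1 exprD -addSnnS.
by rewrite (exprD _ i.+1) (exprS y); ring.
Qed.

Lemma affine_mul_sum (S : comNzRingType) (u v w : S) (c c' : nat -> S) n :
  c n.+1 = 0 -> c' 0%N = u * c 0%N ->
  (forall i, (i <= n)%N -> c' i.+1 = u * c i.+1 + w * c i) ->
  (u + w * v) * (\sum_(i < n.+1) c i * v ^+ i) =
  \sum_(i < n.+2) c' i * v ^+ i.
Proof.
move=> cn c'0 c'S.
have shift_c : \sum_(i < n.+1) c i * v ^+ i =
    c 0%N + \sum_(i < n.+1) c i.+1 * v ^+ i.+1.
  transitivity (\sum_(i < n.+2) c i * v ^+ i).
    by rewrite [RHS]big_ord_recr /= cn mul0r addr0.
  by rewrite big_ord_recl mulr1.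
have -> : \sum_(i < n.+2) c' i * v ^+ i = u * c 0%N +
    (u * (\sum_(i < n.+1) c i.+1 * v ^+ i.+1) +
     w * v * (\sum_(i < n.+1) c i * v ^+ i)).
  rewrite big_ord_recl mulr1 c'0 !mulr_sumr -big_split; congr (_ + _).
  apply: eq_bigr => i _; rewrite /= /bump /= add1n c'S; last by case: i.
  by rewrite exprS; ring.
by rewrite mulrDl {1}shift_c; ring.
Qed.

Definition tcoef a n i : R := (-1) ^+ (i + a) * jcoef a i * qbin q n i.

(** Linear factors are added one at a time, first those in y with b = 0, then those in x. Using X -
    y q^j for 1 - y q^j / X keeps polynomials and shifts exponents by a. *)
Lemma triple_product a b :
  (\prod_(j < b) (1 - (x * q ^+ j)%:P * 'X)) *
  (\prod_(j < a) ('X - (y * q ^+ j)%:P)) =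
  \sum_(i < (a + b).+1) (tcoef a (a + b) i)%:P * 'X^i.
Proof.
elim: b => [|b IHb].
  rewrite big_ord0 mul1r addn0; elim: a => [|a IHa].
    by rewrite big_ord0 big_ord1 /tcoef /jcoef /= !mulr1.
  rewrite big_ord_recr /= IHa mulrC.
  have -> : 'X - (y * q ^+ a)%:P = (- (y * q ^+ a))%:P + 1 * 'X.
    by rewrite polyCN mul1r addrC.
  rewrite (@affine_mul_sum _ _ _ _ (fun i => (tcoef a a i)%:P)
            (fun i => (tcoef a.+1 a.+1 i)%:P)) //.
  - by rewrite /tcoef qbin_small ?mulr0.
  - rewrite -polyCM; congr (polyC _); rewrite /tcoef !qbin0 !mulr1 !add0n.
    by rewrite !(jcoef_l 0) binS bin1 exprD !exprS; ring.
  move=> i ia; rewrite -polyCM mul1r -polyCD; congr (polyC _).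
  rewrite /tcoef qbinS; have -> : jcoef a.+1 i.+1 = jcoef a i by [].
  transitivity ((-1) ^+ (i + a) * jcoef a i * qbin q a i
     + (-1) ^+ (i + a) * qbin q a i.+1 * (q ^+ i.+1 * jcoef a i)).
    by rewrite addnS addSn !exprS; ring.
  by rewrite jcoef_muly addSn exprS; ring.
rewrite big_ord_recr /= mulrAC IHb mulrC addnS.
have -> : 1 - (x * q ^+ b)%:P * 'X = 1%:P + (- (x * q ^+ b))%:P * 'X.
  by rewrite polyCN mulNr.
rewrite (@affine_mul_sum _ _ _ _ (fun i => (tcoef a (a + b) i)%:P)
          (fun i => (tcoef a (a + b).+1 i)%:P)) //.
- by rewrite /tcoef qbin_small ?mulr0.
- by rewrite mul1r /tcoef !qbin0.
move=> i ia; rewrite -!polyCM mul1r -polyCD; congr (polyC _).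
rewrite /tcoef qbinS_sym //.
transitivity ((-1) ^+ (i.+1 + a) * jcoef a i.+1 * qbin q (a + b) i.+1
   + (-1) ^+ (i.+1 + a) * qbin q (a + b) i *
     (q ^+ (a + b - i) * jcoef a i.+1)); first by ring.
by rewrite jcoef_mulx // addSn exprS; ring.
Qed.
End FiniteTripleProduct.

(** * Theta series in a nilpotent variable *)

(** Integer exponents let [ring] handle expressions such as n*n - n; the intended exponents are
    nonnegative. *)
Definition qpow (R : pzRingType) (q : R) (z : int) : R := q ^+ `|z|%N.

(** The inverse of 1 - q^m when q^(N+1) = 0 and m > 0. *)
Definition geo (R : pzRingType) (q : R) (N m : nat) : R :=
  \sum_(i < N.+1) q ^+ (m * i).

(* [geoodd k] is 1 / (1 - q^(2k+1)) and [qgeoodd k] is q^k / (1 - q^(2k+1)); for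
   k = -1-j the fraction is rewritten with the denominator 1 - q^(2j+1). *)
Definition geoodd (R : pzRingType) (q : R) (N : nat) (k : int) : R :=
  match k with
  | Posz k => geo q N k.*2.+1
  | Negz k => 1 - geo q N k.*2.+1
  end.

Definition qgeoodd (R : pzRingType) (q : R) (N : nat) (k : int) : R :=
  match k with
  | Posz k => q ^+ k * geo q N k.*2.+1
  | Negz k => - (q ^+ k * geo q N k.*2.+1)
  end.

(* q^(k^2+k) times the sum of q^(-b^2-b) over |b| <= k. *)
Fixpoint partial_nat (R : pzRingType) (q : R) (k : nat) : R :=
  if k is k'.+1 then q ^+ k.*2 * partial_nat q k' + 1 + q ^+ k.*2 else 1.

Definition partial_int (R : pzRingType) (q : R) (k : int) : R :=
  match k with Posz k => partial_nat q k | Negz k => - partial_nat q k end.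

Lemma sqrB_ge0 (n : int) : 0 <= n * n - n. Proof. nia. Qed.
Lemma sqrD_ge0 (n : int) : 0 <= n * n + n. Proof. nia. Qed.
Lemma sqr_ge0 (n : int) : 0 <= n * n. Proof. nia. Qed.

Lemma qpowD (R : pzRingType) (q : R) (a b : int) :
  0 <= a -> 0 <= b -> qpow q (a + b) = qpow q a * qpow q b.
Proof. by move=> a0 b0; rewrite /qpow -exprD; congr (_ ^+ _); lia. Qed.

Section Nilpotent.
Variables (R : comNzRingType) (q : R) (N : nat).
Hypothesis qN : q ^+ N.+1 = 0.

Local Notation s := (sgi R).
Local Notation Q := (qpow q).

Lemma expr_nil m : (N < m)%N -> q ^+ m = 0.
Proof. by move=> /subnK <-; rewrite exprD qN mulr0. Qed.

Lemma qpow_nil (z : int) : N%:Z < z -> Q z = 0.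
Proof. by move=> Nz; apply: expr_nil; lia. Qed.

Lemma qpow_sqrB_nil (n : int) : (N.+2 < `|n|)%N -> Q (n * n - n) = 0.
Proof. by move=> Nn; apply: qpow_nil; nia. Qed.

Lemma qpow_sqrD_nil (n : int) : (N.+2 < `|n|)%N -> Q (n * n + n) = 0.
Proof. by move=> Nn; apply: qpow_nil; nia. Qed.

Lemma qpow_sqr_nil (n : int) : (N.+2 < `|n|)%N -> Q (n * n) = 0.
Proof. by move=> Nn; apply: qpow_nil; nia. Qed.

Lemma geoE m : (0 < m)%N -> (1 - q ^+ m) * geo q N m = 1.
Proof.
move=> m0; under [geo _ _ _]eq_bigr do rewrite exprM.
rewrite -opprB mulNr -subrX1 -exprM expr_nil ?sub0r ?opprK //.
by rewrite -{1}(mul1n N.+1) leq_mul2r m0 orbT.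
Qed.

Lemma mul_geo m : (0 < m)%N -> q ^+ m * geo q N m = geo q N m - 1.
Proof. by move=> /geoE; rewrite mulrBl mul1r => <-; rewrite subKr. Qed.

Lemma geo_big m : (N < m)%N -> geo q N m = 1.
Proof.
move=> Nm; have := geoE (leq_ltn_trans (leq0n N) Nm).
by rewrite expr_nil // subr0 mul1r.
Qed.

Lemma geoodd_big (k : int) : N%:Z <= k -> geoodd q N k = 1.
Proof. by case: k => k Nk //; rewrite /geoodd geo_big //; lia. Qed.

Lemma geoodd_small (k : int) : k < - N%:Z -> geoodd q N k = 0.
Proof. by case: k => k Nk; [lia | rewrite /geoodd geo_big ?subrr //; lia]. Qed.

Lemma geooddN (k : int) : geoodd q N (-1 - k) = 1 - geoodd q N k.
Proof.
case: k => k.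
  by have -> : -1 - Posz k = Negz k by lia.
have -> : -1 - Negz k = Posz k by lia.
by rewrite /= subKr.
Qed.

Lemma qgeooddN (k : int) : qgeoodd q N (-1 - k) = - qgeoodd q N k.
Proof.
case: k => k.
  by have -> : -1 - Posz k = Negz k by lia.
have -> : -1 - Negz k = Posz k by lia.
by rewrite /= opprK.
Qed.

Lemma qgeoodd_nil (k : int) : (N.+2 < `|k|)%N -> qgeoodd q N k = 0.
Proof. by case: k => k Nk; rewrite /qgeoodd expr_nil ?mul0r ?oppr0 //; lia. Qed.

Lemma partial_nat_big k : (N <= k)%N -> partial_nat q k = 1.
Proof.
case: k => [//|k] Nk /=; rewrite (@expr_nil k.+1.*2) ?mul0r ?add0r ?addr0 //.
lia.
Qed.

Lemma partial_int_big (k : int) : N%:Z <= k -> partial_int q k = 1.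
Proof. by case: k => k Nk //; rewrite /= partial_nat_big. Qed.

Lemma partial_int_small (k : int) : k < - N%:Z -> partial_int q k = -1.
Proof. by case: k => k Nk; [lia | rewrite /= partial_nat_big //; lia]. Qed.

Lemma partial_intN (k : int) : partial_int q (-1 - k) = - partial_int q k.
Proof.
case: k => k.
  by have -> : -1 - Posz k = Negz k by lia.
have -> : -1 - Negz k = Posz k by lia.
by rewrite /= opprK.
Qed.

(** This is u / (1 - u) = 1 / (1 - u) - 1 for u = q^(2k+1), k = m+1-n, multiplied by q^(n^2-n) so
    that no negative power occurs. *)
Lemma geoodd_step (m : nat) (n : int) :
  q ^+ m.*2.+1 * Q ((n - 1) * (n - 1) - (n - 1)) * geoodd q N (m%:Z + 1 - n) =
  Q (n * n - n) * (geoodd q N (m%:Z + 1 - n) - 1).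
Proof.
have -> : q ^+ m.*2.+1 = Q (m%:Z * 2 + 1) by rewrite /qpow; congr (_ ^+ _); lia.
rewrite -qpowD ?sqrB_ge0 //; case E: (m%:Z + 1 - n) => [k|k] /=.
  rewrite -mul_geo // mulrA; congr (_ * _).
  have -> : q ^+ k.*2.+1 = Q (k%:Z * 2 + 1) by rewrite /qpow; congr (_ ^+ _); lia.
  rewrite -qpowD ?sqrB_ge0 //; congr Q; have -> : n = m%:Z + 1 - k%:Z by lia.
  ring.
have -> : 1 - geo q N k.*2.+1 = - (q ^+ k.*2.+1 * geo q N k.*2.+1).
  by rewrite mul_geo // opprB.
have -> : - (q ^+ k.*2.+1 * geo q N k.*2.+1) - 1 = - geo q N k.*2.+1.
  by rewrite mul_geo //; ring.
rewrite !mulrN mulrA; congr (- (_ * _)).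
have -> : q ^+ k.*2.+1 = Q (k%:Z * 2 + 1) by rewrite /qpow; congr (_ ^+ _); lia.
have -> : n = m%:Z + 2 + k%:Z by lia.
rewrite -qpowD; [congr Q; ring | nia | lia].
Qed.

Lemma qgeoodd_geoodd (m : nat) (n : int) :
  Q (n * n) * qgeoodd q N (m%:Z - n) =
  q ^+ m * (Q (n * n - n) * geoodd q N (m%:Z - n)).
Proof.
have -> : q ^+ m = Q m%:Z by [].
rewrite [RHS]mulrA -qpowD ?sqrB_ge0 //; case E: (m%:Z - n) => [k|k] /=.
  rewrite mulrA; congr (_ * _); have -> : q ^+ k = Q k%:Z by [].
  rewrite -qpowD ?sqr_ge0 //; congr Q; have -> : n = m%:Z - k%:Z by lia.
  ring.
have -> : 1 - geo q N k.*2.+1 = - (q ^+ k.*2.+1 * geo q N k.*2.+1).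
  by rewrite mul_geo // opprB.
rewrite !mulrN !mulrA; congr (- (_ * _)).
have -> : q ^+ k.*2.+1 = Q (k%:Z * 2 + 1) by rewrite /qpow; congr (_ ^+ _); lia.
have -> : q ^+ k = Q k%:Z by [].
have -> : n = m%:Z + 1 + k%:Z by lia.
rewrite -!qpowD; [congr Q; ring | nia | lia | nia | lia].
Qed.

(** The recursion t_k = q^(2k) t_(k-1) + 1 + q^(2k) at k = m-n, multiplied by q^(n^2+n) to clear
    negative powers. *)
Lemma partial_int_step (m : nat) (n : int) :
  q ^+ m.*2 * Q (n * n - n) * partial_int q (m%:Z - n - 1) =
  Q (n * n + n) * partial_int q (m%:Z - n) - Q (n * n + n) -
  q ^+ m.*2 * Q (n * n - n).
Proof.
have -> : q ^+ m.*2 = Q (m%:Z * 2) by rewrite /qpow; congr (_ ^+ _); lia.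
rewrite -qpowD ?sqrB_ge0 //; case E: (m%:Z - n) => [[|k]|k].
- have -> : n = m%:Z by lia.
  have -> : m%:Z * 2 + (m%:Z * m%:Z - m%:Z) = m%:Z * m%:Z + m%:Z by ring.
  by rewrite /=; ring.
- have -> : Posz k.+1 - 1 = Posz k by lia.
  have -> : n = m%:Z - k%:Z - 1 by lia.
  have -> : m%:Z * 2 +
      ((m%:Z - k%:Z - 1) * (m%:Z - k%:Z - 1) - (m%:Z - k%:Z - 1))
    = ((m%:Z - k%:Z - 1) * (m%:Z - k%:Z - 1) + (m%:Z - k%:Z - 1)) + (k%:Z * 2 + 2) by ring.
  rewrite qpowD ?sqrD_ge0 //.
  have -> : Q (k%:Z * 2 + 2) = q ^+ k.+1.*2 by rewrite /qpow; congr (_ ^+ _); lia.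
  by rewrite /=; ring.
have -> : Negz k - 1 = Negz k.+1 by lia.
have -> : n = m%:Z + k%:Z + 1 by lia.
set x := m%:Z * 2 + _.
have -> : (m%:Z + k%:Z + 1) * (m%:Z + k%:Z + 1) + (m%:Z + k%:Z + 1) = x + (k%:Z * 2 + 2).
  by rewrite /x; ring.
rewrite (@qpowD _ q x (k%:Z * 2 + 2)) //; [|rewrite /x; nia].
have -> : Q (k%:Z * 2 + 2) = q ^+ k.+1.*2 by rewrite /qpow; congr (_ ^+ _); lia.
by rewrite [partial_int _ _]/= [partial_int _ (Negz k)]/=; ring.
Qed.

Variable L : nat.
Hypothesis NL : (4 * N + 20 <= L)%N.
(** Absence of 2-torsion: sums equal to their own negatives must vanish. *)
Hypothesis char2 : forall x : R, x + x = 0 -> x = 0.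

Local Notation bsum := (bsum L).

Lemma eqN_eq0 (x : R) : x = - x -> x = 0.
Proof. by move=> xN; apply: char2; rewrite {1}xN addNr. Qed.

(** The reflection n -> 1-n fixes n^2 - n and flips the sign. *)
Lemma bsum_alt_sqrB : bsum (fun n => s n * Q (n * n - n)) = 0.
Proof.
apply: eqN_eq0; rewrite -{1}(@bsum_rev _ L N.+2 _ 1); last by lia.
  rewrite -bsum_opp; apply: eq_bsum => n _.
  rewrite sgiD sgiN sgi1 mulN1r mulNr; congr (- (_ * Q _)); ring.
by move=> n Nn; rewrite qpow_sqrB_nil ?mulr0.
Qed.

Lemma bsum_alt_sqrD : bsum (fun n => s n * Q (n * n + n)) = 0.
Proof.
rewrite -bsum_alt_sqrB -bsumN; apply: eq_bsum => n _.
by rewrite sgiN; congr (_ * Q _); ring.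
Qed.

(** Each unit translation of a step function moves one value a out of the window and one value b in.
    This is the source of the factor n in [jacobi]. *)
Lemma bsum_translate (g : int -> R) (a b : R) (n : int) :
  (forall k, N%:Z <= k -> g k = a) -> (forall k, k < - N%:Z -> g k = b) ->
  (`|n| <= N.+2)%N ->
  bsum (fun m => g (m - n)) = bsum g - n%:~R * (a - b).
Proof.
move=> ga gb.
have step (m : int) : (`|m| <= N.+3)%N ->
    bsum (fun k => g (k - m)) = bsum (fun k => g (k - (m + 1))) + (a - b).
  move=> Nm; have := bsumS L (fun k => g (k - (m + 1))).
  rewrite gb ?ga; [|lia|lia] => e.
  rewrite addrA -e addrK; apply: eq_bsum => k _; congr g; lia.
case: n => n Nn.
  elim: n Nn => [|n IHn] Nn.
    by rewrite mul0r subr0; apply: eq_bsum => k _; congr g; lia.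
  have -> : Posz n.+1 = n%:Z + 1 by lia.
  apply: (@addIr _ (a - b)); rewrite -step; last by lia.
  by rewrite IHn ?(ltnW Nn) // intrD; ring.
elim: n Nn => [|n IHn] Nn.
  rewrite step; last by lia.
  rewrite NegzE mulrNz; have -> : - 1%:Z + 1 = 0 by [].
  by rewrite mulNr opprK mul1r; congr (_ + _); apply: eq_bsum => k _; congr g; lia.
rewrite step; last by lia.
have -> : Negz n.+1 + 1 = Negz n by lia.
rewrite IHn; last by lia.
by rewrite !NegzE !mulrNz -(addn1 n.+1) PoszD rmorphD /=; ring.
Qed.

Definition jacobi := bsum (fun n => n%:~R * (s n * Q (n * n + n))).
Definition phi_alt := bsum (fun n => s n * Q (n * n)).
Definition phi := bsum (fun n => Q (n * n)).

(** * The product K theta4 and its constant *)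

Definition conv_geoodd (m : int) :=
  bsum (fun n => s n * Q (n * n - n) * geoodd q N (m - n)).

(** Apply [geoodd_step] termwise; its inhomogeneous part sums to zero by [bsum_alt_sqrB]. *)
Lemma conv_geoodd_rec (m : nat) :
  conv_geoodd (m%:Z + 1) = - (q ^+ m.*2.+1 * conv_geoodd m).
Proof.
rewrite -[LHS]subr0 -bsum_alt_sqrB -bsumB /conv_geoodd.
rewrite -[X in _ * X](@bsum_shift _ L N.+2 _ (-1)); last by lia.
  rewrite mulr_bsumr -bsum_opp; apply: eq_bsum => n _.
  rewrite -[X in _ - X]mulr1 -mulrBr -mulrA -geoodd_step sgiD sgiN sgi1.
  have -> : m%:Z - (n - 1) = m%:Z + 1 - n by ring.
  by ring.
by move=> n Nn; rewrite qpow_sqrB_nil // mulr0 mul0r.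
Qed.

Lemma conv_geooddN (m : int) : conv_geoodd (- m) = conv_geoodd m.
Proof.
rewrite {1}/conv_geoodd -(@bsum_rev _ L N.+2 _ 1); last by lia.
  rewrite -[RHS]subr0 -bsum_alt_sqrB -bsumB; apply: eq_bsum => n _.
  have -> : - m - (1 - n) = -1 - (m - n) by ring.
  rewrite geooddN sgiD sgiN sgi1.
  have -> : (1 - n) * (1 - n) - (1 - n) = n * n - n by ring.
  by ring.
by move=> n Nn; rewrite qpow_sqrB_nil // mulr0 mul0r.
Qed.

Lemma conv_geooddE (m : int) : conv_geoodd m = s m * Q (m * m) * conv_geoodd 0.
Proof.
have conv_nat (n : nat) : conv_geoodd n = s n * Q (n%:Z * n%:Z) * conv_geoodd 0.
  elim: n => [|n IHn]; first by rewrite sgi0 mulr0 /qpow expr0 !mul1r.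
  have -> : Posz n.+1 = n%:Z + 1 by lia.
  rewrite conv_geoodd_rec IHn sgiD sgi1.
  have -> : q ^+ n.*2.+1 = Q (n%:Z * 2 + 1) by rewrite /qpow; congr (_ ^+ _); lia.
  have -> : (n%:Z + 1) * (n%:Z + 1) = n%:Z * n%:Z + (n%:Z * 2 + 1) by ring.
  rewrite (@qpowD _ q (n%:Z * n%:Z)) ?sqr_ge0 //; ring.
case: m => n; first exact: conv_nat.
rewrite NegzE conv_geooddN conv_nat sgiN; congr (_ * Q _ * _); ring.
Qed.

Lemma jacobi_sqrB :
  bsum (fun n => n%:~R * (s n * Q (n * n - n))) = - jacobi.
Proof.
rewrite /jacobi -[X in - X]addr0 -bsum_alt_sqrD -bsumD.
rewrite -(@bsum_shift _ L N.+2 _ 1); last by lia.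
  rewrite -bsum_opp; apply: eq_bsum => n _; rewrite sgiD sgi1 intrD.
  have -> : (n + 1) * (n + 1) - (n + 1) = n * n + n by ring.
  by ring.
by move=> n Nn; rewrite qpow_sqrB_nil // !mulr0.
Qed.

(** Sum the coefficients over all m, that is, put w = 1, where a zero of the theta series meets a
    pole of the other factor. *)
Lemma conv_geoodd0_phi_alt : conv_geoodd 0 * phi_alt = jacobi.
Proof.
transitivity (bsum conv_geoodd).
  by rewrite mulr_bsumr; apply: eq_bsum => m _; rewrite [RHS]conv_geooddE mulrC.
(* In the other order the inner sum is a translated window sum of [geoodd]: its constant part meets
   a vanishing series and its part linear in n gives [jacobi]. *)
rewrite exchange_bsum.
transitivity (bsum (fun n => s n * Q (n * n - n)) * bsum (geoodd q N) -
              bsum (fun n => n%:~R * (s n * Q (n * n - n)))).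
  rewrite mulr_bsuml -bsumB; apply: eq_bsum => n _; rewrite -mulr_bsumr.
  have [Nn|Nn] := leqP `|n|%N N.+2.
    rewrite (@bsum_translate _ 1 0) //; last exact: geoodd_small.
      by rewrite subr0; ring.
    exact: geoodd_big.
  by rewrite qpow_sqrB_nil // !mulr0 !mul0r subr0.
by rewrite bsum_alt_sqrB mul0r sub0r jacobi_sqrB opprK.
Qed.

Lemma conv_qgeoodd (j : int) :
  bsum (fun n => s n * Q (n * n) * qgeoodd q N (j - n)) =
  conv_geoodd 0 * (s j * Q (j * j + j)).
Proof.
have conv_nat (m : nat) :
    bsum (fun n => s n * Q (n * n) * qgeoodd q N (m%:Z - n)) =
    conv_geoodd 0 * (s m * Q (m%:Z * m%:Z + m%:Z)).
  rewrite qpowD ?sqr_ge0 //; have -> : Q m = q ^+ m by [].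
  transitivity (q ^+ m * conv_geoodd m); last first.
    by rewrite [conv_geoodd m]conv_geooddE; ring.
  rewrite mulr_bsumr; apply: eq_bsum => n _.
  by rewrite -mulrA qgeoodd_geoodd; ring.
case: j => m; first exact: conv_nat.
have -> : Negz m = -1 - m%:Z by lia.
rewrite sgiD !sgiN sgi1.
have -> : (-1 - m%:Z) * (-1 - m%:Z) + (-1 - m%:Z) = m%:Z * m%:Z + m%:Z by ring.
rewrite mulN1r mulNr mulrN -conv_nat -bsumN -bsum_opp; apply: eq_bsum => n _.
have -> : -1 - m%:Z - - n = -1 - (m%:Z - n) by ring.
by rewrite qgeooddN sgiN mulrNN mulrN.
Qed.

(** * The product t theta1, compared with theta4 theta3 *)

Definition conv_partial (m : int) :=
  bsum (fun n => s n * Q (n * n + n) * partial_int q (m - n)).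

Lemma conv_partial_rec (m : nat) :
  conv_partial m = - (q ^+ m.*2 * conv_partial (m%:Z - 2)).
Proof.
have -> : conv_partial m = bsum (fun n => s n *
    (q ^+ m.*2 * Q (n * n - n) * partial_int q (m%:Z - n - 1))).
  rewrite -[LHS]subr0 -bsum_alt_sqrD -[LHS]subr0 -(mulr0 (q ^+ m.*2)).
  rewrite -bsum_alt_sqrB mulr_bsumr -!bsumB; apply: eq_bsum => n _.
  by rewrite partial_int_step; ring.
rewrite /conv_partial -[X in _ * X](@bsum_shift _ L N.+2 _ (-1)); last by lia.
  rewrite mulr_bsumr -bsum_opp; apply: eq_bsum => n _.
  rewrite sgiD sgiN sgi1.
  have -> : m%:Z - 2 - (n - 1) = m%:Z - n - 1 by ring.
  have -> : (n - 1) * (n - 1) + (n - 1) = n * n - n by ring.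
  by ring.
by move=> n Nn; rewrite qpow_sqrD_nil // mulr0 mul0r.
Qed.

Lemma conv_partialN (m : int) : conv_partial (-2 - m) = conv_partial m.
Proof.
rewrite {1}/conv_partial -(@bsum_rev _ L N.+2 _ (-1)); last by lia.
  apply: eq_bsum => n _.
  have -> : -2 - m - (-1 - n) = -1 - (m - n) by ring.
  have -> : (-1 - n) * (-1 - n) + (-1 - n) = n * n + n by ring.
  by rewrite partial_intN sgiD !sgiN sgi1; ring.
by move=> n Nn; rewrite qpow_sqrD_nil // mulr0 mul0r.
Qed.

(** The recursion at m = 0 and the reflection m -> -2-m give opposite signs, so [conv_partial (-1)]
    is the only free constant. *)
Lemma conv_partial0 : conv_partial 0 = 0.
Proof.
by apply: eqN_eq0; rewrite {1}(conv_partial_rec 0) expr0 mul1r -[in RHS]conv_partialN.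
Qed.

(** Evaluation at w = 1 again; [partial_int] jumps from -1 to 1, hence the factor two. *)
Lemma sum_conv_partial : bsum conv_partial = - (jacobi + jacobi).
Proof.
rewrite exchange_bsum.
transitivity (bsum (fun n => s n * Q (n * n + n)) * bsum (partial_int q) -
              (jacobi + jacobi)).
  rewrite mulr_bsuml -bsumD -bsumB; apply: eq_bsum => n _; rewrite -mulr_bsumr.
  have [Nn|Nn] := leqP `|n|%N N.+2.
    rewrite (@bsum_translate _ 1 (-1)) //; last exact: partial_int_small.
      by ring.
    exact: partial_int_big.
  by rewrite qpow_sqrD_nil // !mulr0 !mul0r addr0 subr0.
by rewrite bsum_alt_sqrD mul0r sub0r.
Qed.

Definition conv_theta (m : int) :=
  bsum (fun n => s n * Q (n * n) * Q ((m - n) * (m - n))).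

Lemma conv_theta_rec (m : nat) :
  conv_theta (m%:Z + 2) = - (q ^+ m.+1.*2 * conv_theta m).
Proof.
rewrite {1}/conv_theta -(@bsum_shift _ L N.+2 _ 1); last by lia.
  rewrite mulr_bsumr -bsum_opp; apply: eq_bsum => n _; rewrite sgiD sgi1.
  have -> : q ^+ m.+1.*2 = Q (m%:Z * 2 + 2) by rewrite /qpow; congr (_ ^+ _); lia.
  have e : Q ((n + 1) * (n + 1)) * Q ((m%:Z + 2 - (n + 1)) * (m%:Z + 2 - (n + 1))) =
      Q (m%:Z * 2 + 2) * (Q (n * n) * Q ((m%:Z - n) * (m%:Z - n))).
    rewrite -!qpowD ?addr_ge0 ?sqr_ge0 //; congr Q; ring.
  by rewrite mulrN1 !mulNr -!mulrA e; ring.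
by move=> n Nn; rewrite qpow_sqr_nil // mulr0 mul0r.
Qed.

Lemma conv_thetaN (m : int) : conv_theta (- m) = conv_theta m.
Proof.
rewrite -[RHS]bsumN; apply: eq_bsum => n _; rewrite sgiN mulrNN.
by congr (_ * Q _); ring.
Qed.

Lemma conv_theta1 : conv_theta 1 = 0.
Proof.
apply: eqN_eq0; rewrite {1}/conv_theta -(@bsum_rev _ L N.+2 _ 1); last by lia.
  rewrite -bsum_opp; apply: eq_bsum => n _; rewrite subKr sgiD sgiN sgi1; ring.
by move=> n Nn; rewrite qpow_sqr_nil // mulr0 mul0r.
Qed.

(** After an index shift by one both sequences obey the same two-step recursion and symmetry, and
    both have a vanishing parity class, so they are proportional. *)
Lemma conv_theta_partial (m : int) :
  conv_theta 0 * conv_partial m = conv_partial (-1) * conv_theta (m + 1).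
Proof.
have P2 (m' : nat) :
    conv_theta 0 * conv_partial (m'%:Z - 1) =
      conv_partial (-1) * conv_theta m' /\
    conv_theta 0 * conv_partial m'%:Z =
      conv_partial (-1) * conv_theta (m'%:Z + 1).
  elim: m' => [|k [IH1 IH2]].
    by rewrite mulrC conv_partial0 !add0r conv_theta1 !mulr0.
  have -> : Posz k.+1 - 1 = k%:Z by lia.
  have -> : Posz k.+1 = k%:Z + 1 by lia.
  split=> //; have -> : k%:Z + 1 + 1 = k%:Z + 2 by lia.
  rewrite conv_theta_rec mulrN mulrCA -IH1.
  have -> : k%:Z + 1 = k.+1%:Z by lia.
  rewrite conv_partial_rec; have -> : k.+1%:Z - 2 = k%:Z - 1 by lia.
  by ring.
case: m => m; first by have [] := P2 m.
case: m => [|m]; first by have [+ _] := P2 0; rewrite mulrC.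
have -> : Negz m.+1 = -2 - m%:Z by lia.
rewrite conv_partialN; have -> : -2 - m%:Z + 1 = - (m%:Z + 1) by lia.
by rewrite conv_thetaN; have [] := P2 m.
Qed.

Lemma sum_conv_theta : bsum (fun m => conv_theta (m + 1)) = phi_alt * phi.
Proof.
rewrite exchange_bsum mulr_bsuml; apply: eq_bsum => n _; rewrite -mulr_bsumr.
have [Nn|Nn] := leqP `|n|%N N.+2; last by rewrite qpow_sqr_nil // mulr0 !mul0r.
congr (_ * _); rewrite /phi -[RHS](@bsum_shift _ L N.+2 _ (1 - n)).
- by apply: eq_bsum => m _; rewrite addrA.
- exact: qpow_sqr_nil.
by lia.
Qed.

Lemma conv_theta0_jacobi :
  conv_theta 0 * (jacobi + jacobi) = - (conv_partial (-1) * (phi_alt * phi)).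
Proof.
rewrite -[jacobi + jacobi]opprK -sum_conv_partial mulrN; congr (- _).
rewrite -sum_conv_theta !mulr_bsumr; apply: eq_bsum => m _.
by rewrite conv_theta_partial.
Qed.

(** * The product t K and the theta identity for H *)

Definition conv_hecke (m : int) :=
  bsum (fun k => qgeoodd q N k * partial_int q (m - k)).

(** Associativity: theta4 (K t) = (theta4 K) t = c theta1 t. *)
Lemma conv_hecke_theta (m : int) :
  bsum (fun n => s n * Q (n * n) * conv_hecke (m - n)) =
  conv_geoodd 0 * conv_partial m.
Proof.
transitivity (bsum (fun n => bsum (fun j =>
    s n * Q (n * n) * qgeoodd q N (j - n) * partial_int q (m - j)))).
  apply: eq_bsum => n _.
  have [Nn|Nn] := leqP `|n|%N N.+2; last first.
    rewrite qpow_sqr_nil // mulr0 mul0r [RHS]big1 // => i _.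
    by rewrite !mul0r.
  rewrite /conv_hecke -(@bsum_shift _ L N.+2 _ (- n)).
  - rewrite mulr_bsumr; apply: eq_bsum => j _.
    by have -> : m - n - (j - n) = m - j; [ring | rewrite mulrA].
  - by move=> k Nk; rewrite qgeoodd_nil // mul0r.
  by lia.
rewrite exchange_bsum mulr_bsumr; apply: eq_bsum => j _.
by rewrite -mulr_bsuml conv_qgeoodd -!mulrA.
Qed.

(* A convolution kernel 1 + q * (...) is injective because q is nilpotent. *)
Lemma kernel_inj (c u : int -> R) :
  c 0 = 1 -> (forall n : int, n != 0 -> exists d, c n = q * d) ->
  (forall m : int, bsum (fun n => c n * u (m - n)) = 0) ->
  forall m : int, u m = 0.
Proof.
move=> c0 cq cu.
(* The exponent descends from N+1 to 0: once q^(j+1) kills u, multiplying the convolution by q^j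
   leaves only its term n = 0. *)
suff main j : (forall m, q ^+ j * u m = 0) -> forall m : int, u m = 0.
  by apply: (main N.+1) => m; rewrite qN mul0r.
elim: j => [|j IHj] uj; first by move=> m; rewrite -[u m]mul1r -(uj m) expr0.
apply: IHj => m; rewrite -(mulr0 (q ^+ j)) -(cu m) mulr_bsumr bsum_delta.
  by rewrite c0 subr0 mul1r.
move=> n /cq[d ->]; transitivity (d * (q ^+ j.+1 * u (m - n)));
  last by rewrite uj mulr0.
by rewrite exprS; ring.
Qed.

Lemma qpow_div (z : int) : 0 < z -> exists d, Q z = q * d.
Proof.
move=> z0; exists (q ^+ `|z|.-1); rewrite /qpow -exprS; congr (_ ^+ _); lia.
Qed.

(** Both sides agree after convolution with theta4, which can be cancelled by [kernel_inj]. *)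
Lemma conv_theta0_conv_hecke (m : int) :
  conv_theta 0 * conv_hecke m =
  conv_geoodd 0 * conv_partial (-1) * Q ((m + 1) * (m + 1)).
Proof.
apply/eqP; rewrite -subr_eq0; apply/eqP.
pose c n := s n * Q (n * n).
apply: (@kernel_inj c (fun m => conv_theta 0 * conv_hecke m -
   conv_geoodd 0 * conv_partial (-1) * Q ((m + 1) * (m + 1)))).
- by rewrite /c sgi0 mul1r.
- move=> n n0; have [d Ed] := @qpow_div (n * n) ltac:(nia).
  by exists (s n * d); rewrite /c Ed; ring.
move=> {}m; transitivity (conv_theta 0 * (conv_geoodd 0 * conv_partial m) -
   conv_geoodd 0 * (conv_partial (-1) * conv_theta (m + 1))).
  rewrite -(conv_hecke_theta m) [X in _ - X]mulrA [X in X - _]mulr_bsumr.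
  rewrite [X in _ - X]mulr_bsumr -bsumB; apply: eq_bsum => n _.
  have -> : m - n + 1 = m + 1 - n by ring.
  by rewrite /c; ring.
by rewrite -conv_theta_partial; ring.
Qed.

(** [conv_theta 0] is 1 plus a multiple of q; a constant sequence turns the kernel lemma into
    cancellation. *)
Lemma conv_theta0_inj (a : R) : a * conv_theta 0 = 0 -> a = 0.
Proof.
move=> aX; pose c n := s n * Q (n * n) * Q ((0 - n) * (0 - n)).
apply: (@kernel_inj c (fun=> a) _ _ _ 0) => [||m].
- by rewrite /c sgi0 mul1r mulr1.
- move=> n n0; have [d Ed] := @qpow_div (n * n) ltac:(nia).
  by exists (s n * d * Q ((0 - n) * (0 - n))); rewrite /c Ed; ring.
by rewrite -mulr_bsuml mulrC.
Qed.

Definition hecke :=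
  \sum_(k < L) q ^+ k * geo q N k.*2.+1 * partial_nat q k.

(** Both factors are odd under k -> -1-k, so each half of the window gives H; the leftover k = L
    vanishes with q^L. *)
Lemma conv_hecke_m1 : conv_hecke (-1) = - (hecke + hecke).
Proof.
transitivity (- bsum (fun k => qgeoodd q N k * partial_int q k)).
  by rewrite -bsum_opp; apply: eq_bsum => k _; rewrite partial_intN mulrN.
congr (- _); rewrite bsum_halves [X in _ + X](_ : _ = 0) ?addr0.
  by congr (_ + _); apply: eq_bigr => i _; rewrite /= ?mulrNN.
by rewrite /= expr_nil ?mul0r //; lia.
Qed.

Lemma hecke_theta : hecke * phi * phi_alt ^+ 2 = jacobi ^+ 2.
Proof.
have e1 := conv_theta0_conv_hecke (-1).
rewrite conv_hecke_m1 addNr mul0r mulr1 in e1.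
have e2 := conv_theta0_jacobi; have e3 := conv_geoodd0_phi_alt.
apply/eqP; rewrite -subr_eq0; apply/eqP; apply: conv_theta0_inj; apply: char2.
(* Doubling and multiplying by [conv_theta 0] exposes the left sides of [e1] and [e2]; [e3] then
   makes the two terms cancel. *)
have -> : (hecke * phi * phi_alt ^+ 2 - jacobi ^+ 2) * conv_theta 0 +
   (hecke * phi * phi_alt ^+ 2 - jacobi ^+ 2) * conv_theta 0 =
   - (conv_theta 0 * - (hecke + hecke)) * (phi * phi_alt ^+ 2)
     - jacobi * (conv_theta 0 * (jacobi + jacobi)) by ring.
by rewrite e1 e2 -e3; ring.
Qed.

End Nilpotent.

(** * Product formulas *)

Section NilpotentProducts.
Variables (R : comNzRingType) (N L : nat).
Hypothesis NL : (4 * N + 20 <= L)%N.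
Hypothesis char2 : forall x : R, x + x = 0 -> x = 0.
Implicit Types p q x y : R.

Local Notation s := (sgi R).

Lemma nilX q m : (0 < m)%N -> q ^+ N.+1 = 0 -> (q ^+ m) ^+ N.+1 = 0.
Proof.
move=> m0 qN; rewrite -exprM (expr_nil qN) //.
by rewrite -{1}(mul1n N.+1) leq_mul2r m0 orbT.
Qed.

Lemma qfactS p n : qfact p n.+1 = qfact p n * (1 - p ^+ n.+1).
Proof. by rewrite /qfact big_ord_recr. Qed.

Lemma qfact_big p n : p ^+ N.+1 = 0 -> (N <= n)%N -> qfact p n = qfact p N.
Proof.
move=> pN; elim: n => [|n IHn]; first by rewrite leqn0 => /eqP ->.
rewrite leq_eqVlt => /orP[/eqP <- //|Nn].
by rewrite qfactS IHn // (expr_nil pN) // subr0 mulr1.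
Qed.

Lemma qfact_geo p n : p ^+ N.+1 = 0 ->
  qfact p n * \prod_(j < n) geo p N j.+1 = 1.
Proof. by move=> pN; rewrite -big_split big1 // => j _; rewrite /= geoE. Qed.

Lemma qfact_inj p n : p ^+ N.+1 = 0 -> injective ( *%R (qfact p n)).
Proof.
move=> pN; apply: (@can_inj _ _ _ ( *%R (\prod_(j < n) geo p N j.+1))) => a.
by rewrite mulrA [X in X * a]mulrC qfact_geo ?mul1r.
Qed.

(** All three q-factorials of the binomial have length at least N, so each equals [qfact p N]. *)
Lemma qbin_middle p i : p ^+ N.+1 = 0 -> (N <= i)%N -> (i + N <= L + L)%N ->
  qfact p N * qbin p (L + L) i = 1.
Proof.
move=> pN Ni iN; have := qbin_fact p i (L + L - i).
rewrite subnKC; last by lia.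
rewrite !(@qfact_big p) //; [|lia|lia] => e.
by apply: (qfact_inj (n := N) pN); rewrite mulr1 -[RHS]e; ring.
Qed.

(* The infinite triple product is the finite one with both lengths beyond the
   nilpotency order: there the middle q-binomials are the constant 1 / (p; p). *)
Lemma tcoef_bsum p x y (c g : int -> R) :
  p ^+ N.+1 = 0 ->
  (forall i, (i <= L + L)%N -> jcoef p x y L i = c (i%:Z - L%:Z)) ->
  (forall k : int, (N.+2 < `|k|)%N -> c k = 0) ->
  qfact p N * \sum_(i < (L + L).+1) tcoef p x y L (L + L) i * g (i%:Z - L%:Z) =
  bsum L (fun k => s k * c k * g k).
Proof.
move=> pN cE c0; rewrite /bsum addnn mulr_sumr; apply: eq_bigr => -[i /= ltiL] _.
have iL : (i <= L + L)%N by lia.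
rewrite /tcoef cE // -addnn.
have -> : (-1) ^+ (i + L) = s (i%:Z - L%:Z).
  by rewrite /sgi -signr_odd -[RHS]signr_odd; congr (_ ^+ nat_of_bool _); lia.
have [Nk|Nk] := leqP `|i%:Z - L%:Z|%N N.+2; last by rewrite c0 // !(mulr0, mul0r).
rewrite -[RHS]mul1r -(qbin_middle (i := i) pN); [ring | lia | lia].
Qed.

Lemma bin2_sqr k : (k + 'C(k, 2).*2 = k * k)%N.
Proof. by elim: k => // k IHk; rewrite binS bin1; nia. Qed.

Definition oddprod q := \prod_(j < L) (1 - q ^+ j.*2.+1).

(** The triple product in base q^2 with x = y = q, evaluated at X = 1. *)
Lemma phi_alt_prod q : q ^+ N.+1 = 0 ->
  phi_alt q L = qfact (q ^+ 2) N * oddprod q ^+ 2.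
Proof.
move=> qN; have qq : q * q = q ^+ 2 by rewrite expr2.
have /(congr1 (fun P : {poly R} => P.[1])) := triple_product qq L L.
rewrite hornerM !horner_prod horner_sum => e.
have -> : oddprod q ^+ 2 = \sum_(i < (L + L).+1)
   tcoef (q ^+ 2) q q L (L + L) i * (fun=> 1) (i%:Z - L%:Z).
  transitivity (\sum_(i < (L + L).+1)
      ((tcoef (q ^+ 2) q q L (L + L) i)%:P * 'X^i).[1]).
    rewrite -e expr2; congr (_ * _); apply: eq_bigr => j _.
      by rewrite !hornerE -exprM -exprS mul2n.
    by rewrite !hornerE -exprM -exprS mul2n.
  by apply: eq_bigr => i _; rewrite hornerM hornerC hornerXn expr1n.
rewrite [RHS](@tcoef_bsum _ _ _ (fun k => qpow q (k * k)) (fun=> 1)) ?nilX //.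
- by apply: eq_bsum => k _; rewrite mulr1.
- move=> i iL; rewrite /jcoef; case: leqP => ?.
    rewrite -exprM -exprD mul2n bin2_sqr /qpow; congr (_ ^+ _); nia.
  rewrite -exprM -exprD mul2n bin2_sqr /qpow; congr (_ ^+ _); nia.
exact: qpow_sqr_nil.
Qed.

Lemma deriv_1subX (P : {poly R}) : ((1 - 'X) * P)^`().[1] = - P.[1].
Proof.
by rewrite -polyC1 derivM derivB derivX derivC !hornerE; ring.
Qed.

(** The triple product in base p = q^2 with x = 1, y = p, differentiated at the zero X = 1 of its
    first factor. *)
Lemma jacobi_prod q : q ^+ N.+1 = 0 -> jacobi q L = qfact (q ^+ 2) N ^+ 3.
Proof.
move=> qN; have pN := @nilX q 2 isT qN; set p := q ^+ 2 in pN *.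
apply: oppr_inj; rewrite -(jacobi_sqrB qN NL char2).
have /(congr1 (fun P : {poly R} => P^`().[1])) := triple_product (mul1r p) L L.
have prodL (F : nat -> {poly R}) :
    \prod_(j < L) F j = F 0%N * \prod_(j < L.-1) F j.+1.
  by case: (L) NL => [|L'] NL'; [lia | rewrite big_ord_recl].
rewrite (prodL (fun j => 1 - (1 * p ^+ j)%:P * 'X)).
rewrite expr0 mulr1 polyC1 mul1r -mulrA deriv_1subX.
rewrite hornerM !horner_prod raddf_sum horner_sum => e.
have {}e : - (qfact p N ^+ 2) =
    \sum_(i < (L + L).+1) tcoef p 1 p L (L + L) i * i%:R.
  transitivity (\sum_(i < (L + L).+1)
      ((tcoef p 1 p L (L + L) i)%:P * 'X^i)^`().[1]).
    rewrite -e expr2 -{1}(@qfact_big p L.-1) //; last by lia.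
    rewrite -(@qfact_big p L) //; last by lia.
    congr (- (_ * _)); apply: eq_bigr => j _.
      by rewrite !hornerE ?mul1r.
    by rewrite !hornerE /= -exprS.
  apply: eq_bigr => i _.
  by rewrite mul_polyC derivZ derivXn hornerZ hornerMn hornerXn expr1n.
(* Differentiation weights by i = n + L rather than n; the extra L multiplies a vanishing sum. *)
have -> : bsum L (fun n => n%:~R * (s n * qpow q (n * n - n))) =
  bsum L (fun n => s n * qpow q (n * n - n) * n%:~R) +
  bsum L (fun n => s n * qpow q (n * n - n) * L%:R).
  rewrite -mulr_bsuml (bsum_alt_sqrB qN NL char2) mul0r addr0.
  by apply: eq_bsum => n _; rewrite mulrC.
have cE i : (i <= L + L)%N ->
    jcoef p 1 p L i = qpow q ((i%:Z - L%:Z) * (i%:Z - L%:Z) - (i%:Z - L%:Z)).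
  move=> iL; rewrite /jcoef; case: leqP => ?.
    have := bin2_sqr (i - L); rewrite expr1n mul1r -exprM mul2n /qpow => b.
    congr (_ ^+ _); nia.
  have := bin2_sqr (L - i); rewrite -!exprM -exprD /qpow => b.
  congr (_ ^+ _); nia.
rewrite -!(@tcoef_bsum p 1 p (fun n => qpow q (n * n - n))) //; last first.
- exact: qpow_sqrB_nil.
- exact: qpow_sqrB_nil.
rewrite -mulrDr -big_split /= exprS -mulrN e; congr (_ * _).
apply: eq_bigr => i _; rewrite -mulrDr; congr (_ * _).
by rewrite rmorphB /= subrK.
Qed.

Lemma phi_phi_alt q : phi q L = phi_alt (- q) L.
Proof.
apply: eq_bsum => n _; rewrite /qpow /sgi (exprNn q) mulrA.
have -> : (-1) ^+ absz n * (-1) ^+ absz (n * n) = 1 :> R.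
  by rewrite -exprD -signr_odd oddD abszM oddM andbb addbb.
by rewrite mul1r.
Qed.

Lemma oddprodN q : oddprod q * oddprod (- q) = oddprod (q ^+ 2).
Proof.
rewrite -big_split; apply: eq_bigr => j _ /=.
by rewrite exprAC (exprNn q) -signr_odd oddS odd_double; ring.
Qed.

(** Odd and even exponents are separated; lengths L and 2L, both past N, make the split exact. *)
Lemma oddprod_qfact q : q ^+ N.+1 = 0 ->
  oddprod q * qfact (q ^+ 2) N = qfact q N.
Proof.
move=> qN; rewrite -(@qfact_big _ L (nilX _ qN)) //; last by lia.
rewrite -(@qfact_big q L.*2) //; last by lia.
rewrite /oddprod /qfact; elim: L => [|k IHk]; first by rewrite !big_ord0 mulr1.
rewrite doubleS !big_ord_recr /= -IHk -exprM mul2n doubleS; ring.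
Qed.

Lemma hecke_prod q : q ^+ N.+1 = 0 ->
  hecke q N L * qfact q N ^+ 2 = qfact (q ^+ 2) N ^+ 3 * qfact (q ^+ 4) N ^+ 2.
Proof.
move=> qN; have q2N := @nilX q 2 isT qN.
have := hecke_theta qN NL char2.
rewrite phi_phi_alt !phi_alt_prod //; last first.
  by rewrite exprNn qN mulr0.
rewrite sqrrN jacobi_prod // -(oddprod_qfact qN).
have := oddprod_qfact q2N; rewrite -exprM -oddprodN.
set B := qfact (q ^+ 2) N; set C := qfact (q ^+ 4) N.
set O := oddprod q; set P := oddprod (- q); set H := hecke q N L => eC e.
have inj := @qfact_inj _ N q2N; rewrite -/B in inj.
(* The theta identity reads H (B P^2) (B O^2)^2 = B^6, and the invertible B cancels three times. The
   relation O P C = B then finishes. *)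
have eB : H * P ^+ 2 * O ^+ 4 = B ^+ 3.
  by do 3 apply: (inj); transitivity ((B ^+ 3) ^+ 2); [rewrite -e | ]; ring.
transitivity (H * P ^+ 2 * O ^+ 4 * C ^+ 2); last by rewrite eB.
by rewrite -eC; ring.
Qed.
Lemma hecke_quotient q : q ^+ N.+1 = 0 ->
  hecke q N L = qfact (q ^+ 2) N ^+ 3 * qfact (q ^+ 4) N ^+ 2 *
    (\prod_(j < N) geo q N j.+1) ^+ 2.
Proof.
by move=> qN; rewrite -hecke_prod // -mulrA -exprMn qfact_geo // expr1n mulr1.
Qed.

End NilpotentProducts.

(** * Truncated power series *)

Section Truncation.
Variable n : nat.

Local Notation T := {poly %/ ('X^(n.+1) : {poly int})}.
Local Notation trunc := (in_qpoly ('X^(n.+1) : {poly int})).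

Lemma trunc_eq_coef (p r : {poly int}) : trunc p = trunc r -> p`_n = r`_n.
Proof.
move=> /eqP; rewrite -subr_eq0 -rmorphB => /eqP/(congr1 val) /=.
rewrite mk_monic_Xn => /eqP pr.
have /Pdiv.RingMonic.rdvdpP := pr; rewrite monicXn => /(_ isT)[d dE].
by apply/eqP; rewrite -subr_eq0 -coefB dE coefMXn ltnSn.
Qed.

Lemma truncX_nil : trunc 'X ^+ n.+1 = 0.
Proof.
rewrite -rmorphXn; apply: val_inj => /=; rewrite mk_monic_Xn.
by rewrite Pdiv.RingMonic.rmodpp ?monicXn.
Qed.

Lemma trunc_char2 (a : T) : a + a = 0 -> a = 0.
Proof.
move=> /(congr1 val) /= aa; apply: val_inj.
transitivity (0 : {poly int}) => //; apply/polyP => i.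
have := congr1 (fun p : {poly int} => p`_i) aa.
by rewrite coefD !coef0 => /eqP; rewrite -mulr2n mulrn_eq0 => /eqP.
Qed.

Lemma trunc_qpoch m : trunc (qpoch_trunc m n) = qfact (trunc 'X ^+ m) n.
Proof.
rewrite rmorph_prod big_add1 big_mkord; apply: eq_bigr => j _.
by rewrite rmorphB rmorph1 rmorphXn exprM.
Qed.

Lemma trunc_qpoch_inv :
  trunc (qpoch_inv_trunc 1 n) = \prod_(j < n) geo (trunc 'X) n j.+1.
Proof.
rewrite rmorph_prod big_add1 big_mkord; apply: eq_bigr => j _.
by rewrite rmorph_sum; apply: eq_bigr => i _; rewrite rmorphXn mul1n.
Qed.

Lemma trunc_hecke L : trunc (hecke 'X n L) = hecke (trunc 'X) n L.
Proof.
have trunc_partial_nat k : trunc (partial_nat 'X k) = partial_nat (trunc 'X) k.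
  elim: k => [|k IHk]; first exact: rmorph1.
  by rewrite [LHS]/= !rmorphD rmorphM rmorph1 !rmorphXn /= IHk.
rewrite rmorph_sum; apply: eq_bigr => k _.
rewrite !rmorphM rmorphXn rmorph_sum /= trunc_partial_nat; congr (_ * _ * _).
by apply: eq_bigr => i _; rewrite rmorphXn.
Qed.

(** The nilpotent q is the class of X in Z[X]/X^(n+1), which still determines the coefficient of
    X^n. *)
Lemma C_eta_hecke L : (4 * n + 20 <= L)%N -> C_eta n = (hecke 'X n L)`_n.
Proof.
move=> nL; apply: trunc_eq_coef; rewrite trunc_hecke.
rewrite 2!rmorphM 3!rmorphXn /= !trunc_qpoch trunc_qpoch_inv.
by rewrite (hecke_quotient nL trunc_char2 truncX_nil).
Qed.

End Truncation.

(** * Positivity of the coefficients *)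

Lemma hecke_term_over (R : nzRingType) (S : semiringClosed R) N k :
  ('X ^+ k * geo 'X N k.*2.+1 * partial_nat 'X k : {poly R}) \is a polyOver S.
Proof.
apply: rpredM; first apply: rpredM.
- exact: polyOverXn.
- by apply: rpred_sum => i _; apply: polyOverXn.
elim: k => [|k IHk] /=; first exact: rpred1.
apply: rpredD; last exact: polyOverXn.
by apply: rpredD; [apply: rpredM => //; apply: polyOverXn | apply: rpred1].
Qed.

Theorem theorem1p1 (n : nat) : 0 < C_eta n.
Proof.
have [L nL] : exists L, (4 * n + 20 <= L)%N by exists (4 * n + 20)%N.
rewrite (C_eta_hecke nL) /hecke; case: L nL => [|L _]; first by lia.
rewrite big_ord_recl coefD ltr_pwDl //; last first.
  rewrite coef_sum sumr_ge0 // => k _.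
  have /polyOverP/(_ n) : ('X ^+ lift ord0 k * geo 'X n (lift ord0 k).*2.+1 *
      partial_nat 'X (lift ord0 k) : {poly int})
      \is a polyOver (@Num.Def.nneg_num_pred int).
    exact: hecke_term_over.
  by rewrite -nnegrE.
(* The term k = 0 is 1 + X + ... + X^n; its last summand contributes the strictly positive 1. *)
rewrite mul1r mulr1 coef_sum (bigD1 ord_max) //= mul1n coefXn eqxx.
by rewrite ltr_pwDl // sumr_ge0 // => i _; rewrite coefXn ler0n.
Qed.
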